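(* Let $f,g\colon[0,1]\to[-\infty,\infty]$ be strictly monotone continuous functions such that $\min\{|f(0)|,|g(0)|\}<\infty$ and $\min\{|f(1)|,|g(1)|\}<\infty$. For $w\in(0,1)$ let $\mathrm{K}_{w}^{f}$ and $\mathrm{K}_{w}^{g}$ be the quasi-linear means generated by $f$ and $g$. Set $\widehat f=f|_{(0,1)}$, $\widehat g=g|_{(0,1)}$ and $\widehat h=\widehat g\circ\widehat f^{-1}$ (defined on $\operatorname{Ran}(\widehat f)$). (a) Suppose that $\widehat f$ and $\widehat h$ are both strictly increasing or both strictly decreasing. Then the pair $(\mathrm{K}_{w_1}^{f},\mathrm{K}_{w_2}^{g})$ is admissible for all $w_1,w_2\in(0,1)$ with $w_1<w_2$ (resp., for all $w_1,w_2\in(0,1)$ with $w_1>w_2$) if and only if $\widehat h$ is convex (resp., concave). (b) Suppose that $\widehat f$ and $\widehat h$ are strictly monotone with opposite monotonicity. Then the pair $(\mathrm{K}_{w_1}^{f},\mathrm{K}_{w_2}^{g})$ is admissible for all $w_1,w_2\in(0,1)$ with $w_1<w_2$ (resp., for all $w_1,w_2\in(0,1)$ with $w_1>w_2$) if and only if $\widehat h$ is concave (resp., convex).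
   Context: Let $\mathsf{Int}_{[0,1]}=\{[a_1,a_2]: 0\le a_1\le a_2\le 1\}$ (degenerate intervals allowed); write $\mathbf u=[u_1,u_2]$. The interval order is: $\mathbf u\preceq_{\mathrm{Int}}\mathbf x$ iff $u_1\le x_1$ and $u_2\le x_2$. An admissible order is a total order $\preceq$ on $\mathsf{Int}_{[0,1]}$ such that $\mathbf u\preceq_{\mathrm{Int}}\mathbf x$ implies $\mathbf u\preceq\mathbf x$. An aggregation function (AF) is a function $\mathrm A\colon\mathsf{Int}_{[0,1]}\to[0,1]$ with $\mathrm A([0,0])=0$, $\mathrm A([1,1])=1$, and $\mathrm A(\mathbf u)\le\mathrm A(\mathbf x)$ whenever $u_1\le x_1$ and $u_2\le x_2$. For a pair $(\mathrm A,\mathrm B)$ of AFs, the relation $\preceq_{\mathrm A,\mathrm B}$ is defined by: $\mathbf u\preceq_{\mathrm A,\mathrm B}\mathbf x$ iff $\mathrm A(\mathbf u)<\mathrm A(\mathbf x)$, or $\mathrm A(\mathbf u)=\mathrm A(\mathbf x)$ and $\mathrm B(\mathbf u)\le\mathrm B(\mathbf x)$. The pair $(\mathrm A,\mathrm B)$ is admissible if $\preceq_{\mathrm A,\mathrm B}$ is an admissible order. For $w\in(0,1)$ and a strictly monotone continuous $f\colon[0,1]\to[-\infty,\infty]$, the quasi-linear mean generated by $f$ is $\mathrm K_w^f\colon\mathsf{Int}_{[0,1]}\to[0,1]$, $\mathrm K_w^f([z_1,z_2])=f^{-1}\big((1-w)f(z_1)+wf(z_2)\big)$, with the convention $-\infty+\infty=\infty-\infty=-\infty$,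 where $f^{-1}$ is the inverse of $f$ on its range $\operatorname{Ran}(f)$. *)

(* Defs.v *)
From HB Require Import structures.
From mathcomp Require Import all_boot all_order all_algebra.
From mathcomp Require Import all_classical all_reals all_analysis.

Set Implicit Arguments.
Unset Strict Implicit.
Unset Printing Implicit Defensive.

Import Order.TTheory GRing.Theory Num.Theory.
Import numFieldTopology.Exports numFieldNormedType.Exports.

Local Open Scope classical_set_scope.
Local Open Scope ring_scope.
Local Open Scope convex_scope.

(* The pair (u_1, u_2) encodes the interval [u_1, u_2]. *)
Definition int01 (R : realType) : Type :=
  {u : R * R | [&& 0 <= u.1, u.1 <= u.2 & u.2 <= 1]}.

Definition lo (R : realType) (u : int01 R) : R := (val u).1.
Definition hi (R : realType) (u : int01 R) : R := (val u).2.

Lemma int00_subproof (R : realType) :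
  let u : R * R := (0, 0) in [&& 0 <= u.1, u.1 <= u.2 & u.2 <= 1].
Proof. by rewrite /= lexx ler01. Qed.

Lemma int11_subproof (R : realType) :
  let u : R * R := (1, 1) in [&& 0 <= u.1, u.1 <= u.2 & u.2 <= 1].
Proof. by rewrite /= lexx ler01. Qed.

Definition int00 (R : realType) : int01 R := exist _ (0, 0) (int00_subproof R).
Definition int11 (R : realType) : int01 R := exist _ (1, 1) (int11_subproof R).

Definition le_int (R : realType) : rel (int01 R) :=
  fun u x => (lo u <= lo x) && (hi u <= hi x).

Definition total_order (T : Type) (r : rel T) : Prop :=
  [/\ reflexive r, antisymmetric r, transitive r & total r].

Definition admissible_order (R : realType) (r : rel (int01 R)) : Prop :=
  total_order r /\ (forall u x, le_int u x -> r u x).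

Definition aggregation_function (R : realType) (A : int01 R -> R) : Prop :=
  [/\ forall u, 0 <= A u <= 1,
      A (int00 R) = 0,
      A (int11 R) = 1 &
      forall u x, lo u <= lo x -> hi u <= hi x -> A u <= A x].

Definition le_pair (R : realType) (A B : int01 R -> R) : rel (int01 R) :=
  fun u x => (A u < A x) || ((A u == A x) && (B u <= B x)).

Definition admissible_pair (R : realType) (A B : int01 R -> R) : Prop :=
  [/\ aggregation_function A, aggregation_function B &
      admissible_order (le_pair A B)].

Definition strictly_increasing_on d (T : porderType d) d' (T' : porderType d')
    (pT : predType T) (D : pT) (f : T -> T') : Prop :=
  {in D &, {homo f : x y / (x < y)%O}}.

Definition strictly_decreasing_on d (T : porderType d) d' (T' : porderType d')
    (pT : predType T) (D : pT) (f : T -> T') : Prop :=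
  {in D &, {homo f : x y /~ (x < y)%O}}.

(* A function [0,1] -> [-oo, +oo] is given by a map R -> \bar R of which only
   the restriction to [0,1] matters. *)
Definition generator (R : realType) (f : R -> \bar R) : Prop :=
  (strictly_increasing_on `[0, 1] f \/ strictly_decreasing_on `[0, 1] f) /\
  {within `[0, 1], continuous f}.

(* Addition on \bar R satisfies -oo + +oo = +oo + -oo = -oo. The default value
   of 'pinv_ is only taken outside f @` [0,1]. *)
Definition qlmean (R : realType) (w : R) (f : R -> \bar R) (z : int01 R) : R :=
  'pinv_(fun=> 0) `[0, 1] f ((1 - w)%:E * f (lo z) + w%:E * f (hi z))%E.

(* A strictly monotone f : [0,1] -> [-oo, +oo] is finite on (0,1), so that
   f|_(0,1) is a real function, here coerced with fine. *)
Definition hat (R : realType) (f : R -> \bar R) : R -> R := fun x => fine (f x).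

Definition ran_hat (R : realType) (f : R -> \bar R) : set R :=
  hat f @` `]0, 1[.

Definition hath (R : realType) (f g : R -> \bar R) : R -> R :=
  hat g \o 'pinv_(fun=> 0) `]0, 1[ (hat f).

(* Mirror image of convex_function, specialized to R. *)
Definition concave_function (R : realType) (D : set R) (h : R -> R) : Prop :=
  forall t : {i01 R}, {in D &, forall x y : convex_lmodType R^o,
    (h x : R^o) <| t |> h y <= h (x <| t |> y)}.

(* Main.v *)
Require Import Defs.
From HB Require Import structures.
From mathcomp Require Import all_boot all_order all_algebra.
From mathcomp Require Import all_classical all_reals all_analysis.
From mathcomp Require Import ring lra.

Set Implicit Arguments.
Unset Strict Implicit.
Unset Printing Implicit Defensive.

Import Order.TTheory GRing.Theory Num.Theory.
Import numFieldTopology.Exports numFieldNormedType.Exports.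

Local Open Scope classical_set_scope.
Local Open Scope ring_scope.

(**
An admissible pair of means is one that separates intervals. The boundary
hypotheses on f and g make K^f and K^g jointly separate intervals sharing an
endpoint, and each mean separates intervals whose endpoints both move strictly
in the same direction. So a collision can only occur between nested intervals
[b, c] and [a, d], a < b <= c < d; there the common value of f is finite, and
  (1 - w1) (f b - f a) = w1 (f d - f c),   (1 - w2) (g b - g a) = w2 (g d - g c),
i.e. |f b - f a| : |f d - f c| = w1 : 1 - w1, and similarly for g and w2.
Hence collisions with w1 < w2 are excluded exactly when
  |g b - g a| |f d - f c| <= |g d - g c| |f b - f a|,
which compares slopes of chords of g o f^-1, that is, expresses convexity
or concavity. Collisions with w2 < w1 are handled by exchanging f and g.
*)

(** * Monotonicity, range and finiteness of generators *)

Lemma contract_continuous (R : realType) : continuous (@contract R).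
Proof.
move=> x; apply/cvgrPdist_lt => e e0.
(* Balls of [\bar R] are by definition measured through [contract]. *)
exact: (nbhsx_ballx x e e0).
Qed.

Lemma generator_mono (R : realType) (f : R -> \bar R) : generator f ->
  {in `[0, 1] &, {mono f : x y / (x <= y)%O}} \/
  {in `[0, 1] &, {mono f : x y /~ (x <= y)%O}}.
Proof.
by move=> [[fI|fD] _]; [left; apply: le_mono_in|right; apply: le_nmono_in].
Qed.

Lemma generator_inj (R : realType) (f : R -> \bar R) : generator f ->
  {in `[0, 1] &, injective f}.
Proof.
move=> /generator_mono fM x y x01 y01 fxy; apply/eqP; rewrite eq_le.
by case: fM => fM; rewrite -!fM// fxy !lexx.
Qed.

Lemma generator_bounds (R : realType) (f : R -> \bar R) (z : R) :
  generator f -> z \in `[0, 1] ->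
  (Order.min (f 0%R) (f 1%R) <= f z <= Order.max (f 0%R) (f 1%R))%E.
Proof.
move=> gf z01; have /andP[z0 z1] : 0 <= z <= 1 by rewrite in_itv in z01.
rewrite ge_min le_max.
by case: (generator_mono gf) => fM;
  rewrite !fM ?in_itv/= ?lexx ?ler01 ?z0 ?z1 ?orbT.
Qed.

(** [contract] embeds [\bar R] in the reals, continuously and preserving order, so the real
    intermediate value theorem applies to [contract \o f]. *)
Lemma generator_ivt (R : realType) (f : R -> \bar R) (c : \bar R) :
  generator f ->
  (Order.min (f 0%R) (f 1%R) <= c <= Order.max (f 0%R) (f 1%R))%E ->
  exists2 z, z \in `[0, 1] & f z = c.
Proof.
move=> [_ fC] /andP[cl cr].
have kC : {within `[0, 1], continuous (@contract R \o f)}.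
  move=> x; apply: (@cvg_comp _ _ _ f (@contract R) _ (nbhs (f x))).
    exact: fC.
  exact: contract_continuous.
have [|z z01 /contract_inj fz] := IVT (v := contract c) ler01 kC; last by exists z.
have kM : {mono @contract R : x y / (x <= y)%O} by move=> x y; exact: le_contract.
rewrite ge_min le_max /= !kM.
by rewrite ge_min in cl; rewrite le_max in cr; rewrite cl cr.
Qed.

Lemma generator_fin_num (R : realType) (f : R -> \bar R) (z : R) :
  generator f -> 0 < z < 1 -> f z \is a fin_num.
Proof.
move=> [fM _] /andP[z0 z1].
have i0 : (0 : R) \in `[0, 1] by rewrite in_itv/= lexx ler01.
have i1 : (1 : R) \in `[0, 1] by rewrite in_itv/= lexx ler01.
have iz : z \in `[0, 1] by rewrite in_itv/= !ltW.
rewrite fin_numElt; case: fM => fM.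
  by rewrite (le_lt_trans (leNye _) (fM _ _ i0 iz z0))
             (lt_le_trans (fM _ _ iz i1 z1) (leey _)).
by rewrite (le_lt_trans (leNye _) (fM _ _ i1 iz z1))
           (lt_le_trans (fM _ _ iz i0 z0) (leey _)).
Qed.

(** * Weighted means of extended reals *)

Definition wmean (R : realType) (w : R) (x y : \bar R) : \bar R :=
  ((1 - w)%:E * x + w%:E * y)%E.

Lemma wmeanxx (R : realType) (w : R) (x : \bar R) : 0 < w < 1 ->
  wmean w x x = x.
Proof.
move=> /andP[w0 w1]; rewrite /wmean.
case: x => [r||].
- by rewrite -!EFinM -EFinD -mulrDl subrK mul1r.
- by rewrite !gt0_muley ?lte_fin ?subr_gt0.
- by rewrite !gt0_muleNy ?lte_fin ?subr_gt0.
Qed.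

Lemma le_wmean (R : realType) (w : R) (x y x' y' : \bar R) : 0 < w < 1 ->
  (x <= x' -> y <= y' -> wmean w x y <= wmean w x' y')%E.
Proof.
move=> /andP[w0 w1] xx' yy'; apply: leeD; apply: lee_wpmul2l => //;
by rewrite lee_fin ?subr_ge0 ltW.
Qed.

(** Both inequalities are strict because an infinite argument common to the two sides could absorb a
    change in the other. *)
Lemma lt_wmean (R : realType) (w : R) (x y x' y' : \bar R) : 0 < w < 1 ->
  (x < x' -> y < y' -> wmean w x y < wmean w x' y')%E.
Proof.
move=> /andP[w0 w1] xx' yy'; apply: lteD; rewrite lte_pmul2l//;
by rewrite lte_fin ?subr_gt0.
Qed.

Lemma wmean_fin_num (R : realType) (w : R) (x y : \bar R) : 0 < w < 1 ->
  (wmean w x y \is a fin_num) = (x \is a fin_num) && (y \is a fin_num).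
Proof.
move=> /andP[w0 w1]; rewrite /wmean fin_numD.
have H a (z : \bar R) : 0 < a -> (a%:E * z)%E \is a fin_num = (z \is a fin_num).
  move=> a0; case: z => [r||] //; first by rewrite gt0_muley ?lte_fin.
  by rewrite gt0_muleNy ?lte_fin.
by rewrite !H ?subr_gt0.
Qed.

(** A finite term can be subtracted, whereas an infinite one could absorb the other term. At 0 and 1
    this is where the boundary hypotheses on [f] and [g] enter. *)
Lemma wmean_injr (R : realType) (w : R) (x y y' : \bar R) : 0 < w < 1 ->
  x \is a fin_num -> wmean w x y = wmean w x y' -> y = y'.
Proof.
move=> /andP[w0 w1] xf.
move=> /(congr1 (fun z => z - (1 - w)%:E * x)%E).
rewrite /wmean ![((1 - w)%:E * x + _)%E]addeC !addeK ?fin_numM//.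
exact: (inc_inj (lee_pmul2l _ _)).
Qed.

Lemma wmean_injl (R : realType) (w : R) (x x' y : \bar R) : 0 < w < 1 ->
  y \is a fin_num -> wmean w x y = wmean w x' y -> x = x'.
Proof.
move=> /andP[w0 w1] yf.
move=> /(congr1 (fun z => z - w%:E * y)%E).
rewrite /wmean !addeK ?fin_numM//.
by apply: (inc_inj (lee_pmul2l _ _)) => //; rewrite lte_fin subr_gt0.
Qed.

(** * Quasi-linear means as aggregation functions, and admissibility as joint injectivity *)

Lemma int01_itv (R : realType) (u : int01 R) :
  [/\ lo u \in `[0, 1], hi u \in `[0, 1] & lo u <= hi u].
Proof.
rewrite /lo /hi !in_itv/=; have /and3P[a0 ab b1] := valP u.
by rewrite a0 b1 (le_trans a0 ab) (le_trans ab b1).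
Qed.

Lemma int01_eq (R : realType) (u x : int01 R) :
  lo u = lo x -> hi u = hi x -> u = x.
Proof.
move=> l h; apply: val_inj; rewrite [val u]surjective_pairing [RHS]surjective_pairing.
by congr pair.
Qed.

(** A weighted mean of two values of [f] lies between the extreme values of [f], hence in its range,
    so the default of ['pinv_] is never reached. *)
Lemma qlmeanP (R : realType) (w : R) (f : R -> \bar R) (u : int01 R) :
  0 < w < 1 -> generator f ->
  qlmean w f u \in `[0, 1] /\
  f (qlmean w f u) = wmean w (f (lo u)) (f (hi u)).
Proof.
move=> w01 gf.
have [lu hu _] := int01_itv u.
have [z z01 fz] : exists2 z, z \in `[0, 1] & f z = wmean w (f (lo u)) (f (hi u)).
  apply: generator_ivt => //.
  set m := Order.min _ _; set M := Order.max _ _.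
  have /andP[l1 l2] := generator_bounds gf lu.
  have /andP[h1 h2] := generator_bounds gf hu.
  (* Writing [m] and [M] as weighted means of themselves reduces both bounds to monotonicity of
     [wmean]. *)
  by rewrite -(wmeanxx m w01) -(wmeanxx M w01) !le_wmean ?wmeanxx.
have -> : qlmean w f u = z.
  rewrite /qlmean -/(wmean w (f (lo u)) (f (hi u))) -fz pinvKV//.
    by move=> a b; rewrite !inE => ? ?; apply: generator_inj.
  by rewrite inE.
by [].
Qed.

Lemma eq_qlmean (R : realType) (w : R) (f : R -> \bar R) (u x : int01 R) :
  0 < w < 1 -> generator f ->
  qlmean w f u = qlmean w f x <->
  wmean w (f (lo u)) (f (hi u)) = wmean w (f (lo x)) (f (hi x)).
Proof.
move=> w01 gf; have [qu fu] := qlmeanP u w01 gf; have [qx fx] := qlmeanP x w01 gf.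
by rewrite -fu -fx; split => [->//|]; apply: generator_inj.
Qed.

Lemma qlmean_aggregation (R : realType) (w : R) (f : R -> \bar R) :
  0 < w < 1 -> generator f -> aggregation_function (qlmean w f).
Proof.
move=> w01 gf.
have i0 : (0 : R) \in `[0, 1] by rewrite in_itv/= lexx ler01.
have i1 : (1 : R) \in `[0, 1] by rewrite in_itv/= lexx ler01.
have qP u := qlmeanP u w01 gf.
split.
- by move=> u; have [] := qP u; rewrite in_itv.
- by have [q fq] := qP (int00 R); apply: (generator_inj gf) => //; rewrite fq wmeanxx.
- by have [q fq] := qP (int11 R); apply: (generator_inj gf) => //; rewrite fq wmeanxx.
- move=> u x lux hux; have [qu fu] := qP u; have [qx fx] := qP x.
  have [lu hu _] := int01_itv u; have [lx hx _] := int01_itv x.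
  case: (generator_mono gf) => fM; rewrite -fM// fu fx;
  by apply: le_wmean; rewrite ?fM.
Qed.

(** The relation is a lexicographic order pulled back along the pair of means, so it is always a
    total preorder, and monotonicity of the means makes it refine the interval order. Only
    antisymmetry is at stake. *)
Lemma admissible_qlmeanP (R : realType) (w1 w2 : R) (f g : R -> \bar R) :
  0 < w1 < 1 -> 0 < w2 < 1 -> generator f -> generator g ->
  admissible_pair (qlmean w1 f) (qlmean w2 g) <->
  (forall u x : int01 R,
    wmean w1 (f (lo u)) (f (hi u)) = wmean w1 (f (lo x)) (f (hi x)) ->
    wmean w2 (g (lo u)) (g (hi u)) = wmean w2 (g (lo x)) (g (hi x)) -> u = x).
Proof.
move=> w101 w201 gf gg; split.
  move=> [_ _ [[_ anti _ _] _]] u x /eq_qlmean-/(_ w101 gf) fe.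
  move=> /eq_qlmean-/(_ w201 gg) ge; apply: anti.
  by move: fe ge; rewrite /Defs.le_pair => -> ->; rewrite !eqxx !lexx !orbT.
move=> inj.
have aA := qlmean_aggregation w101 gf; have aB := qlmean_aggregation w201 gg.
split => //; split; [split|].
- by move=> u; rewrite /Defs.le_pair eqxx lexx orbT.
- move=> u x; rewrite /Defs.le_pair.
  case: ltgtP => //= fe; case: ltgtP => //= ge _.
  by apply: inj; [apply/(eq_qlmean _ _ w101 gf)|apply/(eq_qlmean _ _ w201 gg)].
- move=> x u y; rewrite /Defs.le_pair.
  case: (ltgtP (qlmean w1 f u)) => //= [ux _|-> ux].
    by case: ltgtP => //= [xy _|<- _]; rewrite ?(lt_trans ux xy) ?ux.
  by case: ltgtP => //= xy; apply: le_trans.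
- by move=> u x; rewrite /Defs.le_pair; case: ltgtP => //= _; exact: le_total.
- move=> u x /andP[l h]; rewrite /Defs.le_pair.
  case: aA => _ _ _ /(_ _ _ l h); rewrite le_eqVlt => /orP[/eqP ->|-> //].
  by rewrite eqxx; case: aB => _ _ _ /(_ _ _ l h) ->; rewrite orbT.
Qed.

(** * Nested intervals and slope domination *)

Lemma wmean_nested (R : realType) (w : R) (f : R -> \bar R) (a b c d : R) :
  0 < w < 1 -> generator f -> 0 <= a -> a < b -> b <= c -> c < d -> d <= 1 ->
  wmean w (f a) (f d) = wmean w (f b) (f c) ->
  [/\ f a \is a fin_num, f d \is a fin_num &
      (1 - w) * (hat f b - hat f a) = w * (hat f d - hat f c)].
Proof.
move=> w01 gf a0 ab bc cd d1 e.
have fb : f b \is a fin_num.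
  by apply: generator_fin_num => //; apply/andP; split; lra.
have fc : f c \is a fin_num.
  by apply: generator_fin_num => //; apply/andP; split; lra.
(* The points [b] and [c] are interior, so the common mean is finite, which forces finite values at
   [a] and [d] too. *)
have : wmean w (f a) (f d) \is a fin_num by rewrite e wmean_fin_num// fb.
rewrite wmean_fin_num// => /andP[fa fd]; split => //.
move: e; rewrite /wmean -(fineK fa) -(fineK fb) -(fineK fc) -(fineK fd).
by rewrite -!EFinM -!EFinD => -[]; rewrite /hat => e; lra.
Qed.

(* With absolute values the condition is insensitive to the signs of F and G, so
   that it covers all four combinations of monotonicity. *)
Definition slope_dominated (R : realType) (F G : R -> R) : Prop :=
  forall a b c d : R, 0 < a -> a < b -> b <= c -> c < d -> d < 1 ->
  `|G b - G a| * `|F d - F c| <= `|G d - G c| * `|F b - F a|.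

(** Only the restriction of [f] to [[0, 1]] is continuous, so a limit at an endpoint has to be taken
    from inside. *)
Lemma hat_cvg_right (R : realType) (f : R -> \bar R) (a : R) :
  generator f -> 0 <= a < 1 -> f a \is a fin_num ->
  hat f x @[x --> a^'+] --> hat f a.
Proof.
move=> [_ /subspace_continuousP fC] /andP[a0 a1] fa.
apply: fine_cvg; rewrite fineK//.
have ai : `[0, 1]%classic a by rewrite /= in_itv/= a0 ltW.
apply: cvg_trans (fC a ai); apply: cvg_app => A nA.
have {}nA : \forall x \near a^'+, `[0, 1]%classic x -> A x.
  rewrite near_withinE; have nA' : \forall x \near nbhs a, `[0, 1]%classic x -> A x := nA.
  by apply: filterS nA' => x Ax _.
apply: (@filterS3 _ a^'+ _ _ _ _ A _ nA (nbhs_right_gt a) (nbhs_right_lt a1)).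
by move=> x Ax ax x1; apply: Ax; rewrite /= in_itv/= !ltW// (le_lt_trans a0).
Qed.

Lemma hat_cvg_left (R : realType) (f : R -> \bar R) (a : R) :
  generator f -> 0 < a <= 1 -> f a \is a fin_num ->
  hat f x @[x --> a^'-] --> hat f a.
Proof.
move=> [_ /subspace_continuousP fC] /andP[a0 a1] fa.
apply: fine_cvg; rewrite fineK//.
have ai : `[0, 1]%classic a by rewrite /= in_itv/= a1 ltW.
apply: cvg_trans (fC a ai); apply: cvg_app => A nA.
have {}nA : \forall x \near a^'-, `[0, 1]%classic x -> A x.
  rewrite near_withinE; have nA' : \forall x \near nbhs a, `[0, 1]%classic x -> A x := nA.
  by apply: filterS nA' => x Ax _.
apply: (@filterS3 _ a^'- _ _ _ _ A _ nA (nbhs_left_lt a) (nbhs_left_gt a0)).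
by move=> x Ax xa x0; apply: Ax; rewrite /= in_itv/= !ltW// (lt_le_trans xa).
Qed.

(* At 0 and 1 the values of f and g may be infinite; where they are finite, the
   inequality extends from the open interval by continuity. *)
Lemma slope_dominated_itvcc (R : realType) (f g : R -> \bar R) (a b c d : R) :
  generator f -> generator g -> slope_dominated (hat f) (hat g) ->
  0 <= a -> a < b -> b <= c -> c < d -> d <= 1 ->
  f a \is a fin_num -> g a \is a fin_num ->
  f d \is a fin_num -> g d \is a fin_num ->
  `|hat g b - hat g a| * `|hat f d - hat f c| <=
  `|hat g d - hat g c| * `|hat f b - hat f a|.
Proof.
move=> gf gg sd a0 ab bc cd d1 fa ga fd gd.
(* One endpoint at a time: the left one tends to [a] while the right one stays at an interior [t];
   afterwards [t] tends to [d]. *)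
have open_d t : c < t -> t < 1 ->
  `|hat g b - hat g a| * `|hat f t - hat f c| <=
  `|hat g t - hat g c| * `|hat f b - hat f a|.
  move=> ct t1.
  have a01 : 0 <= a < 1 by apply/andP; split; lra.
  have fT := hat_cvg_right gf a01 fa; have gT := hat_cvg_right gg a01 ga.
  apply: (ler_cvg_to (a := a^'+)
    (f := fun x => `|hat g b - hat g x| * `|hat f t - hat f c|)
    (g := fun x => `|hat g t - hat g c| * `|hat f b - hat f x|)).
  - by apply: cvgM; [apply: cvg_norm; apply: cvgB => //|]; exact: cvg_cst.
  - by apply: cvgM; [|apply: cvg_norm; apply: cvgB => //]; exact: cvg_cst.
  - near=> x; apply: sd => //.
    by apply: le_lt_trans a0 _; near: x; exact: nbhs_right_gt.
have d01 : 0 < d <= 1 by apply/andP; split; lra.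
have fT := hat_cvg_left gf d01 fd; have gT := hat_cvg_left gg d01 gd.
apply: (ler_cvg_to (a := d^'-)
  (f := fun x => `|hat g b - hat g a| * `|hat f x - hat f c|)
  (g := fun x => `|hat g x - hat g c| * `|hat f b - hat f a|)).
- by apply: cvgM; [|apply: cvg_norm; apply: cvgB => //]; exact: cvg_cst.
- by apply: cvgM; [apply: cvg_norm; apply: cvgB => //|]; exact: cvg_cst.
- near=> x; apply: open_d; first by near: x; exact: nbhs_left_gt.
  by apply: lt_le_trans d1; near: x; exact: nbhs_left_lt.
Unshelve. all: by end_near.
Qed.

(** * Equivalence of slope domination and admissibility *)

Lemma fine_inj (R : realType) (x y : \bar R) :
  x \is a fin_num -> y \is a fin_num -> fine x = fine y -> x = y.
Proof. by move=> xf yf xy; rewrite -(fineK xf) -(fineK yf) xy. Qed.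

Lemma hat_mono (R : realType) (f : R -> \bar R) : generator f ->
  {in `]0, 1[ &, {mono hat f : x y / (x <= y)%O}} \/
  {in `]0, 1[ &, {mono hat f : x y /~ (x <= y)%O}}.
Proof.
move=> gf; have fin z : z \in `]0, 1[ -> z \in `[0, 1] /\ f z \is a fin_num.
  move=> z01; split; last by apply: generator_fin_num => //; rewrite in_itv in z01.
  by move: z01; rewrite !in_itv/= => /andP[? ?]; rewrite !ltW.
case: (generator_mono gf) => fM; [left|right] => x y /fin[xi xf] /fin[yi yf];
by rewrite -lee_fin /hat !fineK// fM.
Qed.

Lemma hat_same_sign (R : realType) (f : R -> \bar R) (a b c d : R) :
  generator f -> 0 < a -> a < b -> b <= c -> c < d -> d < 1 ->
  0 < (hat f b - hat f a) * (hat f d - hat f c).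
Proof.
move=> gf a0 ab bc cd d1.
have [ai bi ci di] :
    [/\ a \in `]0, 1[, b \in `]0, 1[, c \in `]0, 1[ & d \in `]0, 1[].
  by split; rewrite in_itv/=; apply/andP; split; lra.
case: (hat_mono gf) => fM; rewrite ?(leW_mono_in fM) ?(leW_nmono_in fM).
  by rewrite mulr_gt0// subr_gt0 (leW_mono_in fM).
by rewrite nmulr_rgt0 subr_lt0 (leW_nmono_in fM).
Qed.

Lemma normM_same_sign (R : realDomainType) (x y : R) :
  0 < x * y -> `|y| * x = `|x| * y.
Proof.
case: (ltrgt0P x) => [x0|x0|->]; last by rewrite mul0r ltxx.
  by rewrite pmulr_rgt0// => y0; rewrite gtr0_norm// mulrC.
by rewrite nmulr_rgt0// => y0; rewrite ltr0_norm// !mulNr mulrC.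
Qed.

(** An interior lower endpoint has a finite value, which cancels. At 0 one of the two generators is
    finite by hypothesis, and at 1 both intervals are [[1, 1]]. *)
Lemma hi_eq_of_lo_eq (R : realType) (w1 w2 : R) (f g : R -> \bar R)
    (u x : int01 R) :
  0 < w1 < 1 -> 0 < w2 < 1 -> generator f -> generator g ->
  f 0 \is a fin_num \/ g 0 \is a fin_num ->
  wmean w1 (f (lo u)) (f (hi u)) = wmean w1 (f (lo x)) (f (hi x)) ->
  wmean w2 (g (lo u)) (g (hi u)) = wmean w2 (g (lo x)) (g (hi x)) ->
  lo u = lo x -> hi u = hi x.
Proof.
move=> w101 w201 gf gg fg0 fe ge lux.
have [lu hu lhu] := int01_itv u; have [lx hx lhx] := int01_itv x.
move: fe ge; rewrite -lux => fe ge.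
have [u0|] := boolP (0 < lo u); last first.
  rewrite -leNgt => u0; have u00 : lo u = 0.
    by apply/le_anti; rewrite u0; move: lu; rewrite in_itv => /andP[].
  case: fg0 => fin.
    by apply: (generator_inj gf) => //; apply: wmean_injr fe => //; rewrite u00.
  by apply: (generator_inj gg) => //; apply: wmean_injr ge => //; rewrite u00.
have [u1|u1] := ltP (lo u) 1.
  apply: (generator_inj gf) => //; apply: wmean_injr fe => //.
  by apply: generator_fin_num => //; rewrite u0.
by move: hu hx; rewrite !in_itv/= => /andP[_ ?] /andP[_ ?]; lra.
Qed.

Lemma lo_eq_of_hi_eq (R : realType) (w1 w2 : R) (f g : R -> \bar R)
    (u x : int01 R) :
  0 < w1 < 1 -> 0 < w2 < 1 -> generator f -> generator g ->
  f 1 \is a fin_num \/ g 1 \is a fin_num ->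
  wmean w1 (f (lo u)) (f (hi u)) = wmean w1 (f (lo x)) (f (hi x)) ->
  wmean w2 (g (lo u)) (g (hi u)) = wmean w2 (g (lo x)) (g (hi x)) ->
  hi u = hi x -> lo u = lo x.
Proof.
move=> w101 w201 gf gg fg1 fe ge hux.
have [lu hu lhu] := int01_itv u; have [lx hx lhx] := int01_itv x.
move: fe ge; rewrite -hux => fe ge.
have [u1|] := boolP (hi u < 1); last first.
  rewrite -leNgt => u1; have u11 : hi u = 1.
    by apply/le_anti; rewrite u1 andbT; move: hu; rewrite in_itv => /andP[].
  case: fg1 => fin.
    by apply: (generator_inj gf) => //; apply: wmean_injl fe => //; rewrite u11.
  by apply: (generator_inj gg) => //; apply: wmean_injl ge => //; rewrite u11.
have [u0|u0] := ltP 0 (hi u).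
  apply: (generator_inj gf) => //; apply: wmean_injl fe => //.
  by apply: generator_fin_num => //; rewrite u0.
by move: lu lx; rewrite !in_itv/= => /andP[? _] /andP[? _]; lra.
Qed.

Lemma wmean_EFin_eq (R : realType) (w a b c d : R) :
  (1 - w) * (b - a) = w * (d - c) ->
  wmean w a%:E d%:E = wmean w b%:E c%:E.
Proof. by move=> e; rewrite /wmean -!EFinM -!EFinD; congr EFin; lra. Qed.

(** [q / (q + p)] is the weight [w] with [(1 - w) * q = w * p]; comparing slopes thus amounts to
    comparing weights. *)
Lemma lt_ratio (R : realFieldType) (q p q' p' : R) :
  0 < q + p -> 0 < q' + p' -> p' * q < q' * p -> q / (q + p) < q' / (q' + p').
Proof.
by move=> qp q'p' lt_qp; rewrite ltr_pdivrMr// mulrAC ltr_pdivlMr//; lra.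
Qed.

Lemma admissible_slope_dominated (R : realType) (f g : R -> \bar R) :
  generator f -> generator g ->
  f 0 \is a fin_num \/ g 0 \is a fin_num ->
  f 1 \is a fin_num \/ g 1 \is a fin_num ->
  (forall w1 w2 : R, 0 < w1 < 1 -> 0 < w2 < 1 -> w1 < w2 ->
    admissible_pair (qlmean w1 f) (qlmean w2 g)) <->
  slope_dominated (hat f) (hat g).
Proof.
move=> gf gg fg0 fg1; split.
  (* A failure of the slope inequality yields weights [w1 < w2] for which [[a, d]] and [[b, c]]
     collide. *)
  move=> adm a b c d a0 ab bc cd d1; rewrite leNgt; apply/negP => lt_slope.
  have [ai bi ci di] :
      [/\ 0 < a < 1, 0 < b < 1, 0 < c < 1 & 0 < d < 1].
    by split; apply/andP; split; lra.
  have fin z : 0 < z < 1 -> f z = (hat f z)%:E /\ g z = (hat g z)%:E.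
    by move=> z01; rewrite /hat !fineK ?generator_fin_num.
  have sf := hat_same_sign gf a0 ab bc cd d1.
  have sg := hat_same_sign gg a0 ab bc cd d1.
  have norm_gt0 (Q P : R) : 0 < Q * P -> 0 < `|Q| + `|P|.
    move=> QP; rewrite ltr_pwDl// normr_gt0.
    by apply: contraTneq QP => ->; rewrite mul0r ltxx.
  (* Since [Q] and [P] have the same sign, the weight found for their absolute values also solves
     the signed equation. *)
  have weight (Q P : R) : 0 < Q * P -> let w := `|Q| / (`|Q| + `|P|) in
      0 < w < 1 /\ (1 - w) * Q = w * P.
    move=> QP w; have QP0 := norm_gt0 _ _ QP.
    have [Q0 P0] : 0 < `|Q| /\ 0 < `|P|.
      by rewrite !normr_gt0; split; apply: contraTneq QP => ->;
        rewrite ?mul0r ?mulr0 ltxx.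
    split; first by rewrite /w divr_gt0//= ltr_pdivrMr// mul1r ltrDl.
    have nz : `|Q| + `|P| != 0 by rewrite gt_eqF.
    have -> : 1 - w = `|P| / (`|Q| + `|P|).
      by rewrite /w -[X in X - _](divff nz) -mulrBl addrC addKr.
    by rewrite /w mulrAC (normM_same_sign QP) mulrAC.
  have [w1P e1] := weight _ _ sf; have [w2P e2] := weight _ _ sg.
  have w12 := lt_ratio (norm_gt0 _ _ sf) (norm_gt0 _ _ sg) lt_slope.
  have adP : [&& 0 <= (a, d).1, (a, d).1 <= (a, d).2 & (a, d).2 <= 1].
    by apply/and3P; split => /=; lra.
  have bcP : [&& 0 <= (b, c).1, (b, c).1 <= (b, c).2 & (b, c).2 <= 1].
    by apply/and3P; split => /=; lra.
  have /(admissible_qlmeanP w1P w2P gf gg) inj := adm _ _ w1P w2P w12.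
  have [[fa ga] [fb gb]] := (fin _ ai, fin _ bi).
  have [[fc gc] [fd gd]] := (fin _ ci, fin _ di).
  have /(congr1 (@lo R)) : exist _ (a, d) adP = exist _ (b, c) bcP :> int01 R.
    apply: inj; rewrite /lo /hi /= ?fa ?fb ?fc ?fd ?ga ?gb ?gc ?gd;
    exact: wmean_EFin_eq.
  by rewrite /lo/= => ab'; rewrite ab' ltxx in ab.
move=> sd w1 w2 w101 w201 w12; apply/admissible_qlmeanP => // u x.
wlog ux : u x / lo u <= lo x.
  move=> H fe ge; have [|xu] := leP (lo u) (lo x); first by move=> /H; apply.
  by apply/esym/H; rewrite ?ltW.
move=> fe ge.
have [lux|ltux] := eqVneq (lo u) (lo x).
  exact: int01_eq (hi_eq_of_lo_eq w101 w201 gf gg fg0 fe ge lux).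
have {ltux}ux : lo u < lo x by rewrite lt_neqAle ltux.
have [lu hu lhu] := int01_itv u; have [lx hx lhx] := int01_itv x.
(* If both endpoints move up, the means differ strictly; if [hi u = hi x], the lower endpoints agree
   as well. The remaining case has [x] nested in [u]. *)
case: (ltgtP (hi u) (hi x)) => [hux|hxu|/(lo_eq_of_hi_eq w101 w201 gf gg fg1 fe ge) lux].
- exfalso; case: (generator_mono gf) => fM.
    have : (wmean w1 (f (lo u)) (f (hi u)) < wmean w1 (f (lo x)) (f (hi x)))%E.
      by apply: lt_wmean => //; rewrite (leW_mono_in fM).
    by rewrite fe ltxx.
  have : (wmean w1 (f (lo x)) (f (hi x)) < wmean w1 (f (lo u)) (f (hi u)))%E.
    by apply: lt_wmean => //; rewrite (leW_nmono_in fM).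
  by rewrite fe ltxx.
- exfalso.
  have u0 : 0 <= lo u by move: lu; rewrite in_itv => /andP[].
  have u1 : hi u <= 1 by move: hu; rewrite in_itv => /andP[].
  have [fa fd ef] := wmean_nested w101 gf u0 ux lhx hxu u1 fe.
  have [ga gd eg] := wmean_nested w201 gg u0 ux lhx hxu u1 ge.
  have := slope_dominated_itvcc gf gg sd u0 ux lhx hxu u1 fa ga fd gd.
  have /andP[w10 w11] := w101; have /andP[w20 w21] := w201.
  have nf := congr1 Num.norm ef; have ng := congr1 Num.norm eg.
  rewrite !normrM !(gtr0_norm w10) !(gtr0_norm w20) in nf ng.
  rewrite !(@gtr0_norm _ (1 - _)) ?subr_gt0// in nf ng.
  have xfin h : generator h -> h (lo x) \is a fin_num.
    by move=> gh; apply: generator_fin_num => //; apply/andP; split; lra.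
  have Q0 h : generator h -> h (lo u) \is a fin_num ->
      0 < `|hat h (lo x) - hat h (lo u)|.
    move=> gh hf; rewrite normr_gt0 subr_eq0; apply/eqP.
    move=> /(fine_inj (xfin _ gh) hf)/(generator_inj gh lx lu) e.
    by rewrite e ltxx in ux.
  move: (Q0 _ gf fa) (Q0 _ gg ga) nf ng.
  move: `|hat f (lo x) - _| `|hat g (lo x) - _| => Qf Qg.
  move: `|hat f _ - _| `|hat g _ - _| => Pf Pg.
  move=> Qf0 Qg0 nf ng le_slope.
  (* The equations [nf] and [ng] eliminate [Pf] and [Pg] from the slope inequality; the sign that
     remains is that of [w2 - w1], a contradiction. *)
  have : Qf * Qg * (w2 - w1) <= 0.
    have -> : Qf * Qg * (w2 - w1) = w1 * w2 * (Qg * Pf - Pg * Qf).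
      have -> : w1 * w2 * (Qg * Pf - Pg * Qf) =
          w2 * Qg * (w1 * Pf) - w1 * Qf * (w2 * Pg) by ring.
      by rewrite -nf -ng; ring.
    by rewrite pmulr_rle0 ?mulr_gt0// subr_le0.
  by rewrite leNgt !mulr_gt0// subr_gt0.
- by rewrite lux ltxx in ux.
Qed.

(** * Convexity in terms of chords *)

(** Increasing chord slopes, cleared of denominators. The gap from [q] to [r] accommodates the inner
    interval of a nested pair; [q = r] is the usual three-point criterion. *)
Definition chord_le (R : realType) (S : set R) (h : R -> R) : Prop :=
  forall p q r s, S p -> S q -> S r -> S s -> p < q -> q <= r -> r < s ->
    (h q - h p) * (s - r) <= (h s - h r) * (q - p).

Lemma conv_lmodE (R : realType) (t : {i01 R}) (x y : convex_lmodType R^o) :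
  conv t x y = t%:inum * x + (1 - t%:inum) * y :> R.
Proof. by []. Qed.

(** Forward, the slope over [[q, s]] separates those over [[p, q]] and [[r, s]]. Backward, both
    middle points are taken to be the convex combination, which lies in [S] by the hypothesis on
    [S]. *)
Lemma convex_function_chordP (R : realType) (S : set R) (h : R -> R) :
  (forall p q r, S p -> S r -> p < q -> q < r -> S q) ->
  convex_function (S : set (convex_lmodType R^o)) (h : convex_lmodType R^o -> R^o) <->
  chord_le S h.
Proof.
move=> Sitv; split => [cvx|chord].
  have three p q r : S p -> S r -> p < q -> q < r ->
      (h q - h p) * (r - q) <= (h r - h q) * (q - p).
    move=> Sp Sr pq qr; have pr : 0 < r - p by lra.
    (* This is the weight that makes [q] the combination [t * p + (1 - t) * r]. *)
    have t01 : 0 <= (r - q) / (r - p) <= 1.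
      by rewrite divr_ge0 ?ler_pdivrMr//=; lra.
    set t := (r - q) / (r - p) in t01.
    have tE : t * (r - p) = r - q by rewrite /t divfK// gt_eqF.
    have /andP[t0 t1] := t01.
    have := cvx (Itv01 t0 t1) p r.
    rewrite !inE => /(_ Sp Sr); rewrite conv_lmodE convRE/= /unstable.onem.
    have -> : t * p + (1 - t) * r = q by lra.
    move=> le_h; rewrite -subr_ge0.
    have -> : (h r - h q) * (q - p) - (h q - h p) * (r - q) =
      (r - p) * (t * h p + (1 - t) * h r - h q).
      have -> : q = r - t * (r - p) by lra.
      ring.
    by rewrite mulr_ge0 ?subr_ge0// ltW// -subr_gt0.
  move=> p q r s Sp Sq Sr Ss pq qr rs.
  have := three _ _ _ Sp Ss pq (le_lt_trans qr rs).
  have [->//|qr'] := eqVneq q r.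
  have {}qr : q < r by rewrite lt_neqAle qr'.
  have := three _ _ _ Sq Ss qr rs => H2 H1.
  have qs : 0 < s - q by lra.
  by rewrite -(ler_pM2r qs); nra.
move=> t x y; rewrite !inE => Sx Sy.
wlog xy : t x y Sx Sy / x < y.
  move=> H; have [xy|yx|->] := ltgtP x y; first exact: H.
    by rewrite convC [X in _ <= X]convC; exact: H.
  by rewrite !convmm.
(* At weights 0 and 1 the combination is an endpoint and one chord degenerates. *)
have [->|t0] := eqVneq t 0%:i01; first by rewrite !conv0.
have [->|t1] := eqVneq t 1%:i01; first by rewrite !conv1.
rewrite conv_lmodE convRE/= /unstable.onem.
have tgt0 : 0 < t%:inum by rewrite lt_neqAle eq_sym t0 ge0.
have tlt1 : t%:inum < 1 by rewrite lt_neqAle t1 le1.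
move: (t%:inum) tgt0 tlt1 => {t0 t1} {}t t0 t1.
set q := t * x + (1 - t) * y.
have yx : 0 < y - x by lra.
have xq : x < q by rewrite /q; nra.
have qy : q < y by rewrite /q; nra.
have Sq := Sitv _ _ _ Sx Sy xq qy.
have := chord _ _ _ _ Sx Sq Sq Sy xq (lexx q) qy.
have -> : y - q = t * (y - x) by rewrite /q; ring.
have -> : q - x = (1 - t) * (y - x) by rewrite /q; ring.
rewrite !mulrA ler_pM2r//; lra.
Qed.

Lemma concave_functionN (R : realType) (S : set R) (h : R -> R) :
  concave_function S h <->
  convex_function (S : set (convex_lmodType R^o))
    ((fun x => - h x) : convex_lmodType R^o -> R^o).
Proof.
by split => H t x y xS yS; have := H t x y xS yS;
  rewrite !convRE -lerN2 ?opprK opprD ?mulrN ?opprK.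
Qed.

Lemma chord_leNN (R : realType) (S : set R) (h : R -> R) :
  chord_le S (fun x => - - h x) <-> chord_le S h.
Proof.
by split=> H p q r s Sp Sq Sr Ss pq qr rs; have := H p q r s Sp Sq Sr Ss pq qr rs;
  rewrite !opprK.
Qed.

(** * Slope domination as a chord inequality *)

Lemma slope_dominatedNr (R : realType) (F G : R -> R) :
  slope_dominated F (fun x => - G x) <-> slope_dominated F G.
Proof.
by split=> H a b c d a0 ab bc cd d1; have := H a b c d a0 ab bc cd d1;
  rewrite -!opprD !normrN.
Qed.

Lemma slope_dominatedNl (R : realType) (F G : R -> R) :
  slope_dominated (fun x => - F x) G <-> slope_dominated F G.
Proof.
by split=> H a b c d a0 ab bc cd d1; have := H a b c d a0 ab bc cd d1;
  rewrite -!opprD !normrN.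
Qed.

(** Over points of the range written as values of [F], the rises of [h] are increments of [G] and
    the runs are increments of [F]. Exchanging [F] and [G] reverses the inequality, whence [- h]. *)
Lemma slope_dominated_chordP (R : realType) (F G h : R -> R) :
  {in `]0, 1[ &, {mono F : x y / (x <= y)%O}} \/
  {in `]0, 1[ &, {mono F : x y /~ (x <= y)%O}} ->
  {in `]0, 1[ &, {mono G : x y / (x <= y)%O}} ->
  {in `]0, 1[, forall z, h (F z) = G z} ->
  (slope_dominated F G <-> chord_le (F @` `]0, 1[) h) /\
  (slope_dominated G F <-> chord_le (F @` `]0, 1[) (fun x => - h x)).
Proof.
move=> Fmono Gmono hF.
have itv (a b c d : R) : 0 < a -> a < b -> b <= c -> c < d -> d < 1 ->
    [/\ a \in `]0, 1[, b \in `]0, 1[, c \in `]0, 1[ & d \in `]0, 1[].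
  by move=> *; split; rewrite in_itv/=; apply/andP; split; lra.
have gap (K : R -> R) x y : {in `]0, 1[ &, {mono K : x y / (x <= y)%O}} ->
    x \in `]0, 1[ -> y \in `]0, 1[ -> x < y -> `|K y - K x| = K y - K x.
  by move=> KM xi yi xy; rewrite gtr0_norm// subr_gt0 (leW_mono_in KM).
have gapN (K : R -> R) x y : {in `]0, 1[ &, {mono K : x y /~ (x <= y)%O}} ->
    x \in `]0, 1[ -> y \in `]0, 1[ -> x < y -> `|K y - K x| = K x - K y.
  by move=> KM xi yi xy; rewrite distrC gtr0_norm// subr_gt0 (leW_nmono_in KM).
have im z : z \in `]0, 1[ -> (F @` `]0, 1[) (F z) by move=> zi; exists z.
case: Fmono => FM.
  split; split=> H.
  - move=> _ _ _ _ [a ai <-] [b bi <-] [c ci <-] [d di <-].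
    rewrite (leW_mono_in FM) // FM // (leW_mono_in FM) // !hF// => ab bc cd.
    have /andP[a0 _] : 0 < a < 1 by rewrite /= in_itv in ai.
    have /andP[_ d1] : 0 < d < 1 by rewrite /= in_itv in di.
    have := H a b c d a0 ab bc cd d1.
    by rewrite !(gap G)// !(gap F).
  - move=> a b c d a0 ab bc cd d1.
    have [ai bi ci di] := itv _ _ _ _ a0 ab bc cd d1.
    rewrite !(gap G)// !(gap F)// -!hF//.
    by apply: H; rewrite ?(leW_mono_in FM) ?FM//; exact: im.
  - move=> _ _ _ _ [a ai <-] [b bi <-] [c ci <-] [d di <-].
    rewrite (leW_mono_in FM) // FM // (leW_mono_in FM) // !hF// => ab bc cd.
    have /andP[a0 _] : 0 < a < 1 by rewrite /= in_itv in ai.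
    have /andP[_ d1] : 0 < d < 1 by rewrite /= in_itv in di.
    have := H a b c d a0 ab bc cd d1.
    rewrite !(gap G)// !(gap F)//; lra.
  - move=> a b c d a0 ab bc cd d1.
    have [ai bi ci di] := itv _ _ _ _ a0 ab bc cd d1.
    rewrite !(gap G)// !(gap F)// -!hF//.
    have := H _ _ _ _ (im _ ai) (im _ bi) (im _ ci) (im _ di).
    rewrite !(leW_mono_in FM)// FM// => /(_ ab bc cd); lra.
(* For decreasing [F] the four points come in reverse order and the rises of [h] along them are
   negative; the two effects cancel. *)
split; split=> H.
- move=> _ _ _ _ [d di <-] [c ci <-] [b bi <-] [a ai <-].
  rewrite (leW_nmono_in FM) // FM // (leW_nmono_in FM) // !hF// => cd bc ab.
  have /andP[a0 _] : 0 < a < 1 by rewrite /= in_itv in ai.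
  have /andP[_ d1] : 0 < d < 1 by rewrite /= in_itv in di.
  have := H a b c d a0 ab bc cd d1.
  rewrite !(gap G)// !(gapN F)//; lra.
- move=> a b c d a0 ab bc cd d1.
  have [ai bi ci di] := itv _ _ _ _ a0 ab bc cd d1.
  rewrite !(gap G)// !(gapN F)// -!hF//.
  have := H _ _ _ _ (im _ di) (im _ ci) (im _ bi) (im _ ai).
  rewrite !(leW_nmono_in FM)// FM// => /(_ cd bc ab); lra.
- move=> _ _ _ _ [d di <-] [c ci <-] [b bi <-] [a ai <-].
  rewrite (leW_nmono_in FM) // FM // (leW_nmono_in FM) // !hF// => cd bc ab.
  have /andP[a0 _] : 0 < a < 1 by rewrite /= in_itv in ai.
  have /andP[_ d1] : 0 < d < 1 by rewrite /= in_itv in di.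
  have := H a b c d a0 ab bc cd d1.
  rewrite !(gap G)// !(gapN F)//; lra.
- move=> a b c d a0 ab bc cd d1.
  have [ai bi ci di] := itv _ _ _ _ a0 ab bc cd d1.
  rewrite !(gap G)// !(gapN F)// -!hF//.
  have := H _ _ _ _ (im _ di) (im _ ci) (im _ bi) (im _ ai).
  rewrite !(leW_nmono_in FM)// FM// => /(_ cd bc ab); lra.
Qed.

(** * The range of [hat f] and the composite [hath f g] *)

Lemma ran_hat_interval (R : realType) (f : R -> \bar R) (p q r : R) :
  generator f -> ran_hat f p -> ran_hat f r -> p < q -> q < r -> ran_hat f q.
Proof.
move=> gf [x xi <-] [y yi <-] xq qy.
have itvW (z : R) : z \in `]0, 1[ -> z \in `[0, 1].
  by rewrite !in_itv/= => /andP[? ?]; rewrite !ltW.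
have fin (z : R) : z \in `]0, 1[ -> f z \is a fin_num.
  by move=> zi; apply: generator_fin_num => //; rewrite in_itv in zi.
have fxq : (f x < q%:E)%E by rewrite -(fineK (fin _ xi)) lte_fin.
have fqy : (q%:E < f y)%E by rewrite -(fineK (fin _ yi)) lte_fin.
have [z zi fz] : exists2 z, z \in `[0, 1] & f z = q%:E.
  apply: generator_ivt => //.
  have /andP[lx _] := generator_bounds gf (itvW _ xi).
  have /andP[_ ly] := generator_bounds gf (itvW _ yi).
  by rewrite (le_trans lx (ltW fxq)) (le_trans (ltW fqy) ly).
(* The preimage was found in the closed interval; strict monotonicity puts it between [x] and [y],
   hence in the open one. *)
exists z; last by rewrite /hat fz.
have [xc yc] := (itvW _ xi, itvW _ yi).
move: (xi) (yi); rewrite /= !in_itv/= => /andP[x0 x1] /andP[y0 y1].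
rewrite -fz in fxq fqy.
case: (generator_mono gf) => fM.
  move: fxq fqy; rewrite !(leW_mono_in fM) // => ? ?.
  by apply/andP; split; lra.
move: fxq fqy; rewrite !(leW_nmono_in fM) // => ? ?.
by apply/andP; split; lra.
Qed.

Lemma hath_hat (R : realType) (f g : R -> \bar R) : generator f ->
  {in `]0, 1[, forall z, hath f g (hat f z) = hat g z}.
Proof.
move=> gf z zi; rewrite /hath /= pinvKV ?inE//.
move=> x y; rewrite !inE => xi yi fxy; apply/eqP; rewrite eq_le.
by case: (hat_mono gf) => fM; rewrite -(fM x y)// -(fM y x)// fxy lexx.
Qed.

(** The lexicographic order depends on which mean comes first, but joint injectivity does not. *)
Lemma admissible_pairC (R : realType) (w1 w2 : R) (f g : R -> \bar R) :
  0 < w1 < 1 -> 0 < w2 < 1 -> generator f -> generator g ->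
  admissible_pair (qlmean w1 f) (qlmean w2 g) <->
  admissible_pair (qlmean w2 g) (qlmean w1 f).
Proof.
move=> w101 w201 gf gg; split.
  move=> /(admissible_qlmeanP w101 w201 gf gg) H.
  by apply/admissible_qlmeanP => // u x ? ?; apply: H.
move=> /(admissible_qlmeanP w201 w101 gg gf) H.
by apply/admissible_qlmeanP => // u x ? ?; apply: H.
Qed.

(** [hat g] is [hath f g] after [hat f], and two maps of the same monotonicity compose to an
    increasing one. *)
Lemma hat_mono_hath (R : realType) (f g : R -> \bar R) :
  generator f ->
  ((strictly_increasing_on `]0, 1[ (hat f) /\
     strictly_increasing_on (ran_hat f) (hath f g)) \/
    (strictly_decreasing_on `]0, 1[ (hat f) /\
     strictly_decreasing_on (ran_hat f) (hath f g))) ->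
  {in `]0, 1[ &, {mono hat g : x y / (x <= y)%O}}.
Proof.
move=> gf H; apply: le_mono_in => x y xi yi xy.
have ran z : z \in `]0, 1[ -> hat f z \in ran_hat f.
  by move=> zi; rewrite inE; exists z.
rewrite -!(hath_hat g gf)//.
by case: H => -[fM hM]; apply: hM; rewrite ?ran//; apply: fM.
Qed.

Lemma hat_nmono_hath (R : realType) (f g : R -> \bar R) :
  generator f ->
  ((strictly_increasing_on `]0, 1[ (hat f) /\
     strictly_decreasing_on (ran_hat f) (hath f g)) \/
    (strictly_decreasing_on `]0, 1[ (hat f) /\
     strictly_increasing_on (ran_hat f) (hath f g))) ->
  {in `]0, 1[ &, {mono hat g : x y /~ (x <= y)%O}}.
Proof.
move=> gf H; apply: le_nmono_in => x y xi yi xy.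
have ran z : z \in `]0, 1[ -> hat f z \in ran_hat f.
  by move=> zi; rewrite inE; exists z.
rewrite -!(hath_hat g gf)//.
by case: H => -[fM hM]; apply: hM; rewrite ?ran//; apply: fM.
Qed.

Theorem theorem4p9 (R : realType) (f g : R -> \bar R)
    (hf : generator f) (hg : generator g)
    (h0 : (Order.min `|f 0%R| `|g 0%R| < +oo)%E)
    (h1 : (Order.min `|f 1%R| `|g 1%R| < +oo)%E) :
  (((strictly_increasing_on `]0, 1[ (hat f) /\
     strictly_increasing_on (ran_hat f) (hath f g)) \/
    (strictly_decreasing_on `]0, 1[ (hat f) /\
     strictly_decreasing_on (ran_hat f) (hath f g))) ->
    ((forall w1 w2 : R, 0 < w1 < 1 -> 0 < w2 < 1 -> w1 < w2 ->
        admissible_pair (qlmean w1 f) (qlmean w2 g)) <->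
      convex_function (ran_hat f) (hath f g)) /\
    ((forall w1 w2 : R, 0 < w1 < 1 -> 0 < w2 < 1 -> w2 < w1 ->
        admissible_pair (qlmean w1 f) (qlmean w2 g)) <->
      concave_function (ran_hat f) (hath f g)))
  /\
  (((strictly_increasing_on `]0, 1[ (hat f) /\
     strictly_decreasing_on (ran_hat f) (hath f g)) \/
    (strictly_decreasing_on `]0, 1[ (hat f) /\
     strictly_increasing_on (ran_hat f) (hath f g))) ->
    ((forall w1 w2 : R, 0 < w1 < 1 -> 0 < w2 < 1 -> w1 < w2 ->
        admissible_pair (qlmean w1 f) (qlmean w2 g)) <->
      concave_function (ran_hat f) (hath f g)) /\
    ((forall w1 w2 : R, 0 < w1 < 1 -> 0 < w2 < 1 -> w2 < w1 ->
        admissible_pair (qlmean w1 f) (qlmean w2 g)) <->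
      convex_function (ran_hat f) (hath f g))).
Proof.
have fin_min (x y : \bar R) : (Order.min `|x| `|y| < +oo)%E ->
    x \is a fin_num \/ y \is a fin_num.
  by rewrite gt_min -!ge0_fin_numE ?abse_ge0// !abse_fin_num => /orP.
have fg0 := fin_min _ _ h0; have fg1 := fin_min _ _ h1.
have gf0 : g 0 \is a fin_num \/ f 0 \is a fin_num by case: fg0; [right|left].
have gf1 : g 1 \is a fin_num \/ f 1 \is a fin_num by case: fg1; [right|left].
have ltP := admissible_slope_dominated hf hg fg0 fg1.
(* Exchanging the generators reduces [w2 < w1] to the case already treated. *)
have gtP : (forall w1 w2 : R, 0 < w1 < 1 -> 0 < w2 < 1 -> w2 < w1 ->
    admissible_pair (qlmean w1 f) (qlmean w2 g)) <->
    slope_dominated (hat g) (hat f).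
  rewrite -(admissible_slope_dominated hg hf gf0 gf1).
  by split=> H w1 w2 w101 w201 w12; apply/admissible_pairC => //; apply: H.
have Sitv p q r := @ran_hat_interval _ f p q r hf.
have cvxP := convex_function_chordP (hath f g) Sitv.
have ccvP := concave_functionN (ran_hat f) (hath f g).
rewrite (convex_function_chordP (fun x => - hath f g x) Sitv) in ccvP.
have fM := hat_mono hf; have hF := hath_hat g hf.
rewrite ltP gtP cvxP ccvP; split => [/(hat_mono_hath hf) gM|/(hat_nmono_hath hf) gM].
  exact: (slope_dominated_chordP fM gM hF).
(* Slope domination does not see the sign of [hat g], so a decreasing [hat g] is replaced by its
   negative. This negates [hath f g], and convexity and concavity trade places. *)
have NgM : {in `]0, 1[ &, {mono (fun x => - hat g x) : x y / (x <= y)%O}}.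
  by move=> x y xi yi; rewrite lerN2 gM.
have NhF : {in `]0, 1[, forall z, - hath f g (hat f z) = - hat g z}.
  by move=> z zi; rewrite hF.
have := slope_dominated_chordP (h := fun x => - hath f g x) fM NgM NhF.
by rewrite slope_dominatedNr slope_dominatedNl chord_leNN.
Qed.
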